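(* For any $p\in(2,\infty)$ there exist $\delta>0$ and $C(p)>0$ such that for all sufficiently large $N$ there is a sequence $\xi_1,\ldots,\xi_N$ of independent identically distributed real random variables having $\mathsf{E}\xi_i=0$, $\mathsf{E}|\xi_i|^p=1$, and $$ d_{N^{1-\delta}}(\{\xi_1,\ldots,\xi_N\},L_p)\le C(p)N^{-\delta}. $$
   Context: $L_p$ is the space of random variables with finite $p$-th moment on the underlying probability space, $\|f\|_p=(\mathsf{E}|f|^p)^{1/p}$. The Kolmogorov width is $d_n(K,X)=\inf_{Q_n}\sup_{f\in K}\inf_{g\in Q_n}\|f-g\|_X$, the infimum being over linear subspaces $Q_n\subset X$ of dimension at most $n$ (here with $n=N^{1-\delta}$, i.e. subspaces of dimension at most $N^{1-\delta}$). *)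

(* Defs.v *)
From HB Require Import structures.
From mathcomp Require Import all_boot all_order all_algebra.
From mathcomp Require Import all_classical all_reals all_analysis.

Set Implicit Arguments.
Unset Strict Implicit.
Unset Printing Implicit Defensive.

Import Order.TTheory GRing.Theory Num.Theory.
Import numFieldNormedType.Exports.

Local Open Scope classical_set_scope.
Local Open Scope ring_scope.

Section KolmogorovWidth.
Context (R : realType) (V : lmodType R).

Definition lin_indep (m : nat) (e : 'I_m -> V) : Prop :=
  forall c : 'I_m -> R, \sum_(i < m) c i *: e i = 0 -> forall i, c i = 0.

Definition lin_span (m : nat) (e : 'I_m -> V) : set V :=
  [set \sum_(i < m) c i *: e i | c in [set: 'I_m -> R]].

(* The bound x is real, so that x = N `^ (1 - delta) needs no rounding. *)
Definition subspace_dim_le (x : R) (Q : set V) : Prop :=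
  exists (m : nat) (e : 'I_m -> V),
    [/\ m%:R <= x, lin_indep e & Q = lin_span e].

Local Open Scope ereal_scope.

(* The norm is passed as a bare function nm because the library does not equip
   LfunType, for which this is used, with a norm structure.  Infima and suprema
   are taken in \bar R, where they are total. *)
Definition kolmogorov_width (nm : V -> \bar R) (x : R) (K : set V) : \bar R :=
  ereal_inf [set ereal_sup [set ereal_inf [set nm (f - g)%R | g in Q]
                           | f in K]
            | Q in subspace_dim_le x].

End KolmogorovWidth.

Section LpWidth.
Context d (T : measurableType d) (R : realType) (P : probability T R).
Variables (p : \bar R) (p1 : (1 <= p)%E).

(* LfunType consists of functions, not of classes modulo a.e. equality.  This
   does not change the width: a subspace of the quotient lifts to one of the
   same dimension, the image of a subspace in the quotient has no larger
   dimension, and the L_p norm is constant on classes. *)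
Definition Lp_width (x : R) (K : set (LfunType P p1)) : \bar R :=
  kolmogorov_width (fun f : LfunType P p1 => 'N[P]_p[EFin \o f]%E) x K.

End LpWidth.

Section IID.
Context d (T : measurableType d) (R : realType) (P : probability T R).
Context (I : finType).

Definition mutually_independent (X : I -> {RV P >-> R}) : Prop :=
  forall (J : {set I}) (B : I -> set R),
    (forall i, measurable (B i)) ->
    P (\bigcap_(i in [set` J]) (X i @^-1` B i)) =
      (\prod_(i in J) P (X i @^-1` B i))%E.

Definition identically_distributed (X : I -> {RV P >-> R}) : Prop :=
  forall (i j : I) (A : set R), measurable A ->
    distribution P (X i) A = distribution P (X j) A.

End IID.

Lemma le1_of_gt2 (R : realType) (p : R) : 2 < p -> (1 <= p%:E)%E.
Proof. by move=> p2; rewrite lee_fin (le_trans _ (ltW p2)) ?ler1n. Qed.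

(* Main.v *)
Require Import Defs.
From HB Require Import structures.
From mathcomp Require Import all_boot all_order all_algebra.
From mathcomp Require Import finfield ring lra.
From mathcomp Require Import all_classical all_reals all_analysis.
Import Order.TTheory GRing.Theory Num.Theory.
Import numFieldNormedType.Exports.
Local Open Scope classical_set_scope.
Local Open Scope ring_scope.

(** The random variables are rare large spikes: xi_i = N^(1/p) eta_i with
    eta_i independent, equal to 1 and to -1 with probability 1/(2N) each and to
    0 otherwise, so that E|xi_i|^p = 1.  The number K of nonzero eta_i has
    moments bounded uniformly in N: since x^p <= p^p e^x, independence gives
    E K^p <= p^p E e^K = p^p (1 + (e-1)/N)^N <= p^p e^(e-1)
    ([support_size_moment]).  Hence a combination of the xi_j with coefficients
    at most c in absolute value has L_p norm at most C_p c N^(1/p), whatever the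
    number of its terms.

    It remains to find a matrix A of rank at most N^(1-delta) all of whose
    entries are close to those of the identity: xi_i is then approximated by
    sum_j A_ij xi_j, which ranges over a space of dimension rank A.  Let F be a
    field with q elements.  The graphs S_i of N distinct polynomials of degree
    at most 2 over F are q-element subsets of the q^2-element plane F x F, and
    two of them share at most 2 points ([near_disjoint_sets]).  The normalised
    Gram matrix A_ij = |S_i cap S_j| / q has rank at most q^2, diagonal 1 and
    off-diagonal entries in [0, 2/q], and can be formed as soon as N <= q^3.

    The approximation error is therefore of order N^(1/p) / q.  Taking q to be
    the largest power of 2 that is at most N^((1-delta)/2), it is of order
    N^(1/p - (1-delta)/2), which equals N^(-delta) for
    delta = (p - 2) / (3p).  As 3 (1-delta) / 2 = 1 + 1/p exceeds 1, the
    condition N <= q^3 holds for large N ([scale_choice]). *)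

(** * Upper bounds on widths *)

(** A linear dependence expresses one of the spanning vectors through the
    others, so that it can be dropped; this is repeated until none is left. *)
Lemma lin_span_basis (R : realType) (V : lmodType R) (n : nat) (e : 'I_n -> V) :
  exists (m : nat) (b : 'I_m -> V),
    [/\ (m <= n)%N, lin_indep b & lin_span b = lin_span e].
Proof.
elim: n e => [|n IHn] e; first by exists 0%N, e; split => // c _ [].
(* c is a nontrivial relation, in which e i0 has a nonzero coefficient *)
have [|/existsNP[c /not_implyP[ce0 /existsNP[i0 /eqP ci0]]]] := pselect (lin_indep e).
  by exists n.+1, e.
have [m [b [mn indb spanb]]] := IHn (e \o lift i0).
exists m, b; split => //; first exact: leqW.
rewrite spanb; apply/seteqP; split => v [a _ <-].
  exists (fun i => if unlift i0 i is Some j then a j else 0) => //.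
  rewrite (bigD1_ord i0) //= unlift_none scale0r add0r.
  by apply: eq_bigr => j _; rewrite liftK.
exists (fun j => a (lift i0 j) - a i0 / c i0 * c (lift i0 j)) => //.
have e_i0 : e i0 = - \sum_(j < n) (c (lift i0 j) / c i0) *: e (lift i0 j).
  apply: (scalerI ci0); move: ce0; rewrite (bigD1_ord i0) //= => /eqP.
  rewrite addr_eq0 => /eqP ->; rewrite scalerN scaler_sumr; congr (- _).
  by apply: eq_bigr => j _; rewrite scalerA mulrCA divff ?mulr1.
rewrite (bigD1_ord i0) //= e_i0 scalerN scaler_sumr addrC -sumrB.
apply: eq_bigr => j _; rewrite /= scalerBl scalerA; congr (_ - _ *: _).
by rewrite mulrA mulrAC.
Qed.

(** The spanning family h of the approximating space may be dependent, unlike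
    the bases in the definition of the width. *)
Lemma kolmogorov_width_le (R : realType) (V : lmodType R) (nm : V -> \bar R)
    (x : R) (K : set V) (m : nat) (h : 'I_m -> V) (c : \bar R) :
  m%:R <= x ->
  (forall f, K f -> exists2 g, lin_span h g & (nm (f - g)%R <= c)%E) ->
  (kolmogorov_width nm x K <= c)%E.
Proof.
move=> mx approx; have [m' [b [m'm indb spanb]]] := lin_span_basis R V m h.
apply: (le_trans (y := ereal_sup [set ereal_inf
    [set nm (f - g)%R | g in lin_span h] | f in K])).
  apply: ereal_inf_lbound; exists (lin_span h) => //.
  exists m', b; split => //; apply: le_trans mx; by rewrite ler_nat.
apply: ge_ereal_sup => _ [f Kf <-]; have [g hg fg] := approx f Kf.
by apply: le_trans fg; apply: ereal_inf_lbound; exists g.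
Qed.

(** The left-hand sum is the i-th row of the normalised Gram matrix of the sets
    S applied to x.  Grouping it by the points z exhibits it as a combination of
    the #|Z| vectors obtained by summing x over the sets through z, which bounds
    the rank of the approximation by #|Z|. *)
Lemma gram_approximation (R : realType) (V : lmodType R) (I Z : finType)
    (S : I -> {set Z}) (q : nat) (x : I -> V) (i : I) :
  (0 < q)%N -> #|S i| = q ->
  x i - \sum_z ((z \in S i)%:R / q%:R : R) *: \sum_(j | z \in S j) x j =
    - \sum_(j | j != i) (#|S i :&: S j|%:R / q%:R) *: x j.
Proof.
move=> q0 Siq.
have -> : \sum_z ((z \in S i)%:R / q%:R : R) *: \sum_(j | z \in S j) x j =
    \sum_j (#|S i :&: S j|%:R / q%:R) *: x j.
  under eq_bigr do rewrite scaler_sumr big_mkcond /=.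
  rewrite exchange_big /=; apply: eq_bigr => j _.
  rewrite -sum1_card natr_sum mulr_suml scaler_suml [RHS]big_mkcond /=.
  apply: eq_bigr => z _; rewrite inE.
  by case: (z \in S i); case: (z \in S j); rewrite //= mul0r scale0r.
rewrite (bigD1 i) //= finset.setIid Siq divff ?pnatr_eq0 -?lt0n // scale1r.
by rewrite opprD addrA subrr add0r.
Qed.

(** * Nearly disjoint sets from polynomials over a finite field *)

Definition quad (F : finFieldType) (t : F * F * F) : {poly F} :=
  t.1.1%:P + t.1.2 *: 'X + t.2 *: 'X^2.

Lemma quad_inj (F : finFieldType) : injective (@quad F).
Proof.
move=> [[a b] c] [[a' b'] c'] /polyP eqp.
have := eqp 0%N; have := eqp 1%N; have := eqp 2%N.
rewrite /quad !coefD !coefC !coefZ !coefX !coefXn /=.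
by rewrite !mulr0 !mulr1 !addr0 !add0r => -> -> ->.
Qed.

Lemma size_quad (F : finFieldType) (t : F * F * F) : (size (quad F t) <= 3)%N.
Proof.
apply/leq_sizeP => j j3; rewrite /quad !coefD !coefC !coefZ !coefX !coefXn.
by case: j j3 => [|[|[|j]]] //= _; rewrite !mulr0 !addr0.
Qed.

Definition parabola (F : finFieldType) (t : F * F * F) : {set F * F} :=
  (fun x => (x, (quad F t).[x])) @: F.

Lemma card_parabola (F : finFieldType) t : #|parabola F t| = #|F|.
Proof. by rewrite card_imset // => x y []. Qed.

(** A common point of two graphs sits over a root of the difference of the two
    polynomials, which is nonzero of degree at most 2. *)
Lemma card_parabolaI (F : finFieldType) t u : t != u ->
  (#|parabola F t :&: parabola F u| <= 2)%N.
Proof.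
move=> tu; pose p := quad F t - quad F u.
have p0 : p != 0 by rewrite subr_eq0 (inj_eq (@quad_inj F)).
pose r : {set F} := finset (root p).
have sub : parabola F t :&: parabola F u \subset (fun x => (x, (quad F t).[x])) @: r.
  apply/fintype.subsetP => z /setIP[/imsetP[x _ ->] /imsetP[y _ [-> eqx]]].
  by apply/imsetP; exists y => //; rewrite inE rootE hornerD hornerN eqx subrr.
apply: (leq_trans (subset_leq_card sub)); apply: (leq_trans (leq_imset_card _ _)).
have size_p : (size p <= 3)%N.
  by rewrite (leq_trans (size_polyD _ _)) // geq_max size_polyN !size_quad.
have /max_poly_roots : all (root p) (enum r).
  by apply/allP => x; rewrite mem_enum inE.
move=> /(_ p0 (enum_uniq _)); rewrite -cardE => ltr.
by rewrite -ltnS (leq_trans ltr).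
Qed.

(** Powers of 2 are used as field orders because there is one between y/2 and y
    for each y >= 1. *)
Lemma near_disjoint_sets (k N : nat) : (0 < k)%N -> (N <= (2 ^ k) ^ 3)%N ->
  exists (Z : finType) (S : 'I_N -> {set Z}),
    [/\ #|Z| = ((2 ^ k) ^ 2)%N, forall i, #|S i| = (2 ^ k)%N &
        forall i j, i != j -> (#|S i :&: S j| <= 2)%N].
Proof.
move=> k0 Nq; have [F _ cardF] := pPrimePowerField (isT : prime 2) k0.
have leN : (N <= #|{: F * F * F}|)%N.
  by rewrite !card_prod cardF (leq_trans Nq) // !expnS expn0 muln1 mulnA.
pose t (i : 'I_N) : F * F * F := enum_val (widen_ord leN i).
have t_inj : injective t by move=> i j /enum_val_inj /(congr1 val) /= /val_inj.
exists (F * F)%type, (fun i => parabola F (t i)); split=> [|i|i j ij].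
- by rewrite card_prod cardF.
- by rewrite card_parabola.
- by rewrite card_parabolaI // (inj_eq t_inj).
Qed.

(** * Finite probability spaces *)

(** Measurable types are pointed, so the point has to be part of the type. *)
Definition discrete (T : choiceType) (t0 : T) : Type := T.

Arguments discrete [T] t0.

HB.instance Definition _ (T : choiceType) (t0 : T) := Choice.on (discrete t0).
HB.instance Definition _ (T : choiceType) (t0 : T) :=
  isPointed.Build (discrete t0) t0.
HB.instance Definition _ (T : choiceType) (t0 : T) :=
  @isMeasurable.Build default_measure_display (discrete t0)
    discrete_measurable discrete_measurable0
    discrete_measurableC discrete_measurableU.

Lemma measurable_discrete (T : choiceType) (t0 : T) d (U : measurableType d)
  (f : discrete t0 -> U) : measurable_fun setT f.
Proof. by []. Qed.

Section FiniteProbability.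
Context (R : realType) (T : finType) (t0 : T) (w : T -> R).
Hypotheses (w_ge0 : forall t, 0 <= w t) (w_sum1 : \sum_t w t = 1).

Local Notation D := (discrete t0).

Let atom (n : nat) : {measure set D -> \bar R} :=
  mscale (NngNum (w_ge0 (nth t0 (enum T) n)))
         (dirac (nth t0 (enum T) n : D) : {measure set D -> \bar R}).

(** The proof that the weights add up to 1 is an argument because the
    probability structure, which is inferred from the term, depends on it. *)
Definition fin_prob : set D -> \bar R := let _ := w_sum1 in msum atom #|T|.

HB.instance Definition _ := Measure.on fin_prob.

Let sum_atom (F : T -> \bar R) :
  (\sum_(n < #|T|) F (nth t0 (enum T) n) = \sum_t F t)%E.
Proof.
rewrite [RHS](reindex _ (onW_bij _ (@enum_val_bij T))) /=.
by apply: eq_bigr => i _; rewrite -(enum_val_nth t0).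
Qed.

Lemma fin_probE (A : set D) : fin_prob A = (\sum_t w t * \1_A t)%:E.
Proof.
rewrite /fin_prob /msum -sumEFin -(sum_atom (fun t => (w t * \1_A t)%:E)).
by apply: eq_bigr => n _; rewrite EFinM.
Qed.

Let fin_prob_setT : fin_prob setT = 1%E.
Proof.
by rewrite fin_probE; under eq_bigr do rewrite indicT mulr1; rewrite w_sum1.
Qed.

HB.instance Definition _ := Measure_isProbability.Build _ _ _ fin_prob fin_prob_setT.

Let ge0_integral_fin_prob (f : D -> R) : (forall t, 0 <= f t) ->
  (\int[fin_prob]_t (f t)%:E = (\sum_t w t * f t)%:E)%E.
Proof.
move=> f0; rewrite ge0_integral_measure_sum //; last by move=> t _; rewrite lee_fin.
rewrite -sumEFin -(sum_atom (fun t => (w t * f t)%:E)); apply: eq_bigr => n _.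
rewrite ge0_integral_mscale //; last by move=> t _; rewrite lee_fin.
by rewrite integral_dirac // diracT mul1e EFinM.
Qed.

(** Reduced to nonnegative functions by splitting f into positive and negative
    parts. *)
Lemma integral_fin_prob (f : D -> R) :
  (\int[fin_prob]_t (f t)%:E = (\sum_t w t * f t)%:E)%E.
Proof.
rewrite integralE.
rewrite [X in (X - _)%E](_ : _ = (\int[fin_prob]_t (Num.max (f t) 0)%:E)%E); last first.
  by apply: eq_integral => t _; rewrite funeposE EFin_max.
rewrite [X in (_ - X)%E](_ : _ = (\int[fin_prob]_t (Num.max (- f t) 0)%:E)%E); last first.
  by apply: eq_integral => t _; rewrite funenegE EFin_max.
rewrite !ge0_integral_fin_prob; [|by move=> t; rewrite le_max lexx orbT..].
rewrite -EFinB -sumrB; congr (_%:E); apply: eq_bigr => t _.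
rewrite -mulrBr; congr (_ * _).
case: (leP 0 (f t)) => [f0|/ltW f0].
  by rewrite (max_idPr _) ?oppr_le0 // subr0.
by rewrite (max_idPl _) ?oppr_ge0 // sub0r opprK.
Qed.

Lemma Lfun_fin_prob (p : R) (f : D -> R) : f \in Lfun fin_prob p%:E.
Proof.
apply/andP; split; first by rewrite inE; exact: measurable_discrete.
apply/mem_set; rewrite /= /finite_norm unlock /= poweR_lty //.
under eq_integral do rewrite -?abse_EFin ?poweR_EFin.
by rewrite integral_fin_prob ltry.
Qed.

End FiniteProbability.

Arguments fin_prob [R T] t0 [w] w_ge0 w_sum1 _.

Lemma Lnorm_fin_prob (R : realType) (T : finType) (t0 : T) (w : T -> R)
    (w_ge0 : forall t, 0 <= w t) (w_sum1 : \sum_t w t = 1) (p : R)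
    (f : discrete t0 -> R) :
  'N[fin_prob t0 w_ge0 w_sum1]_p%:E[EFin \o f]%E =
    ((\sum_t w t * `|f t| `^ p) `^ p^-1)%:E.
Proof.
rewrite unlock /=; under eq_integral do rewrite -?abse_EFin ?poweR_EFin.
by rewrite integral_fin_prob poweR_EFin.
Qed.

(** * Independent coordinates of a product space *)

Section ProductProbability.
Context (R : realType) (V : finType) (v0 : V) (N : nat) (mu : V -> R).
Hypotheses (mu_ge0 : forall v, 0 <= mu v) (mu_sum1 : \sum_v mu v = 1).

Definition prod_weight (t : {ffun 'I_N -> V}) : R := \prod_i mu (t i).

(** Independence of the coordinates: expectations of products factorise. *)
Lemma sum_prod_weight (g : 'I_N -> V -> R) :
  \sum_t prod_weight t * \prod_i g i (t i) = \prod_i \sum_v mu v * g i v.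
Proof.
by rewrite bigA_distr_bigA; apply: eq_bigr => t _; rewrite -big_split.
Qed.

Lemma sum_prod_weight1 (i : 'I_N) (f : V -> R) :
  \sum_t prod_weight t * f (t i) = \sum_v mu v * f v.
Proof.
pose g j v := if j == i then f v else 1.
transitivity (\sum_t prod_weight t * \prod_j g j (t j)).
  apply: eq_bigr => t _; rewrite (bigD1 i) //= big1 ?mulr1 /g ?eqxx //.
  by move=> j /negbTE ->.
rewrite sum_prod_weight (bigD1 i) //= /g eqxx [X in _ * X]big1 ?mulr1 //.
by move=> j /negbTE ->; under eq_bigr do rewrite mulr1.
Qed.

Lemma prod_weight_ge0 t : 0 <= prod_weight t.
Proof. exact: prodr_ge0. Qed.

Lemma prod_weight_sum1 : \sum_t prod_weight t = 1.
Proof.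
transitivity (\sum_t prod_weight t * \prod_(i < N) (fun=> 1) (t i)).
  by apply: eq_bigr => t _; rewrite big1 ?mulr1.
rewrite (sum_prod_weight (fun _ _ => 1)) big1 // => i _.
by under eq_bigr do rewrite mulr1.
Qed.

Definition prod_prob : probability _ R :=
  fin_prob [ffun=> v0] prod_weight_ge0 prod_weight_sum1.

Variables (x : V -> R) (X : 'I_N -> {RV prod_prob >-> R}).
Hypothesis XE : forall i t, X i t = x (t i).

Lemma prod_prob_coord i (B : set R) :
  prod_prob (X i @^-1` B) = (\sum_v mu v * \1_B (x v))%:E.
Proof.
rewrite -(sum_prod_weight1 i (fun v => \1_B (x v))).
etransitivity; first exact: fin_probE.
by congr (_%:E); apply: eq_bigr => t _; rewrite !indicE -XE.
Qed.

Lemma identically_distributed_coord : identically_distributed X.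
Proof. by move=> i j A _; rewrite /distribution /pushforward !prod_prob_coord. Qed.

(** The indicator of the intersection is a product over the coordinates, with
    the factor 1 outside J, so that its expectation factorises. *)
Lemma mutually_independent_coord : mutually_independent X.
Proof.
move=> J B _; under [RHS]eq_bigr do rewrite prod_prob_coord.
rewrite prodEFin; etransitivity; first exact: fin_probE.
congr (_%:E).
pose g i v : R := if i \in J then \1_(B i) (x v) else 1.
transitivity (\sum_t prod_weight t * \prod_i g i (t i)).
  apply: eq_bigr => t _; congr (_ * _).
  rewrite /g -big_mkcond /= indicE.
  have [|] := boolP (t \in _).
    move=> /set_mem tB; rewrite big1 // => i iJ.
    by rewrite indicE mem_set // -XE; exact: tB.
  move=> /negP tB; apply/esym/eqP/prodf_eq0.
  have /existsNP[i /not_implyP[iJ tBi]] : ~ forall i, i \in J -> B i (x (t i)).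
    move=> tJ; apply: tB; apply/mem_set => i /= iJ.
    by rewrite XE; exact: tJ.
  by exists i => //; rewrite indicE memNset.
rewrite sum_prod_weight [RHS]big_mkcond; apply: eq_bigr => i _; rewrite /g.
by case: ifP => // _; under eq_bigr do rewrite mulr1.
Qed.

End ProductProbability.

(** * Sparse random signs *)

(** Follows from ln y <= y at y = x / p. *)
Lemma powR_le_expR (R : realType) (p x : R) : 0 < p -> 0 <= x ->
  x `^ p <= p `^ p * expR x.
Proof.
move=> p0; rewrite le_eqVlt => /predU1P[<-|x0].
  by rewrite powR0 ?gt_eqF // mulr_ge0 ?powR_ge0 ?expR_ge0.
have -> : x `^ p = p `^ p * (x / p) `^ p.
  by rewrite -powRM ?divr_ge0 ?ltW // mulrCA divff ?mulr1 // gt_eqF.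
rewrite ler_wpM2l ?powR_ge0 // /powR gt_eqF ?divr_gt0 // ler_expR.
rewrite -ler_pdivlMl // mulrC.
by apply/ltW/ln_sublinear; rewrite mulr_gt0 ?invr_gt0.
Qed.

Section SparseSigns.
Context (R : realType) (N : nat).
Hypothesis N_gt0 : (0 < N)%N.

Definition sgn_val (v : option bool) : R :=
  if v is Some b then (-1) ^+ b else 0.

Definition sgn_weight (v : option bool) : R :=
  if v is Some b then (2 * N%:R)^-1 else 1 - N%:R^-1.

Let NR_gt0 : 0 < N%:R :> R. Proof. by rewrite ltr0n. Qed.

Lemma sum_option_bool (F : option bool -> R) :
  \sum_v F v = F None + (F (Some true) + F (Some false)).
Proof.
rewrite (bigD1 None) //= (bigD1 (Some true)) //= (bigD1 (Some false)) //=.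
by rewrite big1 ?addr0 // => -[[]|].
Qed.

Lemma sgn_weight_ge0 v : 0 <= sgn_weight v.
Proof.
case: v => [b|] /=; first by rewrite invr_ge0 mulr_ge0 // ltW.
by rewrite subr_ge0 invf_le1 // ler1n.
Qed.

Lemma sgn_expectation (f : R -> R) :
  \sum_v sgn_weight v * f (sgn_val v) =
    f 0 + (f 1 + f (-1) - 2 * f 0) / (2 * N%:R).
Proof.
rewrite sum_option_bool /= expr0 expr1.
by field; rewrite gt_eqF.
Qed.

Lemma sgn_weight_sum1 : \sum_v sgn_weight v = 1.
Proof.
have := sgn_expectation (fun=> 1); under eq_bigr do rewrite mulr1.
by move=> ->; field; rewrite gt_eqF.
Qed.

(** The number of nonzero signs, written as a sum that factorises under the
    exponential. *)
Definition support_size (t : {ffun 'I_N -> option bool}) : R :=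
  \sum_i `|sgn_val (t i)|.

(** The exponential moment factorises over the coordinates, each contributing
    1 + (e - 1) / N <= e ^ ((e - 1) / N). *)
Lemma support_size_moment (p : R) : 0 < p ->
  \sum_t prod_weight R _ N sgn_weight t * support_size t `^ p <=
    p `^ p * expR (expR 1 - 1).
Proof.
move=> p0; set w := prod_weight _ _ _ _.
have w_ge0 t : 0 <= w t by apply: prod_weight_ge0; exact: sgn_weight_ge0.
apply: (le_trans (y := \sum_t w t * (p `^ p * expR (support_size t)))).
  apply: ler_sum => t _; rewrite ler_wpM2l // powR_le_expR // sumr_ge0 //.
under eq_bigr do rewrite mulrCA.
rewrite -mulr_sumr ler_wpM2l ?powR_ge0 //.
under eq_bigr do rewrite /support_size expR_sum.
rewrite (sum_prod_weight _ _ _ _ (fun _ v => expR `|sgn_val v|)).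
under eq_bigr do rewrite (sgn_expectation (fun y => expR `|y|)).
rewrite normr0 normr1 normrN1 expR0 prodr_const card_ord.
have -> : 1 + (expR 1 + expR 1 - 2 * 1) / (2 * N%:R) =
    1 + (expR 1 - 1) / N%:R :> R by field; rewrite gt_eqF.
apply: (le_trans (y := expR ((expR 1 - 1) / N%:R) ^+ N)).
  apply: lerXn2r; rewrite ?nnegrE ?expR_ge0 ?expR_ge1Dx //.
by rewrite -expRM_natl mulrC divfK // gt_eqF.
Qed.

End SparseSigns.

(** * The spikes and their width *)

Lemma Lfun_sumE d (T : measurableType d) (R : realType) (P : probability T R)
    (p : \bar R) (p1 : (1 <= p)%E) (I : Type) (r : seq I) (Q : pred I)
    (F : I -> LfunType P p1) (t : T) :
  (\sum_(i <- r | Q i) F i) t = \sum_(i <- r | Q i) F i t.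
Proof. by elim/big_rec2: _ => // i y1 y2 _ <-. Qed.

Section Construction.
Context (R : realType) (p : R) (p_gt2 : 2 < p) (N : nat) (N_gt0 : (0 < N)%N).

Let p_gt0 : 0 < p. Proof. exact: lt_trans p_gt2. Qed.

Let P : probability _ R :=
  prod_prob R _ None N (sgn_weight R N) (sgn_weight_ge0 R N N_gt0)
    (sgn_weight_sum1 R N N_gt0).

Let M : R := N%:R `^ p^-1.

Definition spike_fun (i : 'I_N) (t : discrete [ffun=> None]) : R :=
  M * sgn_val R ((t : {ffun 'I_N -> option bool}) i).

Let spike_fun_Lfun i : spike_fun i \in Lfun P p%:E.
Proof. exact: Lfun_fin_prob. Qed.

Definition spike (i : 'I_N) : LfunType P (le1_of_gt2 p_gt2) :=
  Lfun_Sub (le1_of_gt2 p_gt2) (spike_fun_Lfun i).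

Lemma spike_independent : mutually_independent (fun i => spike i : {RV P >-> R}).
Proof. exact: (@mutually_independent_coord _ _ _ _ _ _ _ (fun v => M * sgn_val R v)). Qed.

Lemma spike_identically_distributed :
  identically_distributed (fun i => spike i : {RV P >-> R}).
Proof. exact: (@identically_distributed_coord _ _ _ _ _ _ _ (fun v => M * sgn_val R v)). Qed.

Lemma expectation_spike (f : R -> R) (i : 'I_N) :
  ('E_P[fun t => f (spike i t)] =
    (f 0 + (f M + f (- M) - 2 * f 0) / (2 * N%:R))%:E)%E.
Proof.
rewrite unlock integral_fin_prob; congr (_%:E).
rewrite (sum_prod_weight1 _ _ _ _ (sgn_weight_sum1 R N N_gt0) i
  (fun v => f (M * sgn_val R v))).
by rewrite (sgn_expectation R N N_gt0 (fun y => f (M * y))) mulr0 mulr1 mulrN1.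
Qed.

(** Pointwise, the error of the Gram approximation is at most
    (2 / q) N^(1/p) K with q = 2^k and K the number of nonzero signs. *)
Lemma width_spike (k : nat) (x : R) : (0 < k)%N -> (N <= (2 ^ k) ^ 3)%N ->
  ((2 ^ k) ^ 2)%:R <= x ->
  (Lp_width x (range spike) <=
    (2 / (2 ^ k)%:R * M * (p `^ p * expR (expR 1 - 1)) `^ p^-1)%:E)%E.
Proof.
move=> k0 Nk kx; have [Z [S [cardZ cardS cardSI]]] := near_disjoint_sets k N k0 Nk.
set q := (2 ^ k)%N in cardS *.
have q0 : (0 < q)%N by rewrite expn_gt0.
pose h (z : Z) := \sum_(j | z \in S j) spike j.
apply: (@kolmogorov_width_le _ _ _ _ _ #|Z| (fun n => h (enum_val n))).
  by rewrite cardZ.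
move=> _ [i _ <-].
exists (\sum_z ((z \in S i)%:R / q%:R : R) *: h z).
  exists (fun n => (enum_val n \in S i)%:R / q%:R) => //.
  by rewrite [RHS](reindex _ (onW_bij _ (@enum_val_bij Z))).
rewrite gram_approximation // Lnorm_fin_prob lee_fin.
set w := prod_weight _ _ _ _.
set c := 2 / q%:R * M.
have M0 : 0 <= M by exact: powR_ge0.
have c0 : 0 <= c by rewrite !mulr_ge0 // invr_ge0.
have w0 t : 0 <= w t by apply: prod_weight_ge0; exact: sgn_weight_ge0.
have K0 t : 0 <= support_size R N t by exact: sumr_ge0.
have bound (t : {ffun 'I_N -> option bool}) :
    `|(- \sum_(j | j != i) (#|S i :&: S j|%:R / q%:R) *: spike j : LfunType _ _) t| <=
    c * support_size R N t.
  rewrite [X in `|X|](_ : _ = - (\sum_(j | j != i) (#|S i :&: S j|%:R / q%:R) *: spike j) t) //.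
  rewrite normrN Lfun_sumE; apply: (le_trans (ler_norm_sum _ _ _)).
  rewrite /support_size mulr_sumr [leRHS](bigD1 i) //=.
  (* the term of index i on the right is spare, as the left sum omits it *)
  rewrite ler_wpDl ?mulr_ge0 //; apply: ler_sum => j ji.
  rewrite [X in `|X|](_ : _ = #|S i :&: S j|%:R / q%:R * (M * sgn_val R (t j))) //.
  rewrite !normrM mulrA ler_wpM2r // (ger0_norm M0) ler_wpM2r //.
  rewrite normr_nat normfV normr_nat ler_wpM2r ?invr_ge0 // ler_nat.
  by rewrite cardSI // eq_sym.
apply: (le_trans (y := (c `^ p * (p `^ p * expR (expR 1 - 1))) `^ p^-1)).
  apply: ge0_ler_powR; rewrite ?invr_ge0 ?(ltW p_gt0) ?nnegrE //.
  - by apply: sumr_ge0 => t _; rewrite mulr_ge0 // powR_ge0.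
  - by rewrite !mulr_ge0 ?powR_ge0 ?expR_ge0.
  apply: le_trans (ler_wpM2l (powR_ge0 _ _) (support_size_moment R N N_gt0 p p_gt0)).
  rewrite mulr_sumr; apply: ler_sum => t _; rewrite mulrCA ler_wpM2l //.
  rewrite -powRM //.
  by apply: ge0_ler_powR; rewrite ?(ltW p_gt0) ?nnegrE ?mulr_ge0 ?bound.
rewrite powRM ?powR_ge0 // ?mulr_ge0 ?powR_ge0 ?expR_ge0 //.
by rewrite -powRrM mulfV ?gt_eqF // powRr1.
Qed.

End Construction.

(** * Choice of the parameters *)

Lemma power2_below (R : realType) (y : R) : 1 <= y ->
  exists k : nat, (2 ^ k)%:R <= y < 2 * (2 ^ k)%:R.
Proof.
move=> y1; have y0 : 0 <= y by exact: le_trans y1.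
have [yl yu] := andP (truncn_itv y0).
have t0 : (0 < Num.truncn y)%N by rewrite truncn_gt0.
exists (trunc_log 2 (Num.truncn y)); apply/andP; split.
  by apply: le_trans yl; rewrite ler_nat trunc_logP.
apply: (lt_le_trans yu); rewrite -natrM -expnS ler_nat.
exact: trunc_log_ltn.
Qed.

(** With y = N^((1-delta)/2), the choice of delta is the one for which
    N^(1/p) / y = N^(-delta), and then y^3 = N * N^(1/p).  The factor N^(1/p),
    at least 8, absorbs the loss between y^3 and the cube of a power of 2 that
    is only known to exceed y / 2. *)
Lemma scale_choice (R : realType) (p : R) (N : nat) (delta := (p - 2) / (3 * p)) :
  2 < p -> 8 `^ p <= N%:R ->
  exists2 k : nat, (0 < k)%N & [/\ (N <= (2 ^ k) ^ 3)%N,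
    ((2 ^ k) ^ 2)%:R <= N%:R `^ (1 - delta) &
    2 / (2 ^ k)%:R * N%:R `^ p^-1 <= 4 * N%:R `^ (- delta)].
Proof.
move=> p2 N8; have p0 : 0 < p by exact: lt_trans p2.
have N8' : 8 <= N%:R :> R.
  by apply: le_trans N8; apply: le1r_powR; rewrite ?ler1n // ltW // (lt_trans _ p2) // ltr1n.
have N0 : 0 < N%:R :> R by exact: lt_le_trans N8'.
have N1 : 1 <= N%:R :> R by apply: le_trans N8'; rewrite ler1n.
have Np : 8 <= N%:R `^ p^-1 :> R.
  have -> : 8 = (8 `^ p) `^ p^-1 :> R by rewrite -powRrM mulfV ?gt_eqF // powRr1.
  by apply: ge0_ler_powR; rewrite ?nnegrE ?powR_ge0 ?invr_ge0 // ltW.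
have powD a b : N%:R `^ a * N%:R `^ b = N%:R `^ (a + b) :> R.
  by rewrite powRD ?(gt_eqF N0) ?implybT.
pose y : R := N%:R `^ ((1 - delta) / 2).
have y0 : 0 < y by exact: powR_gt0.
have y2 : y ^+ 2 = N%:R `^ (1 - delta) by rewrite expr2 powD; congr (powR _ _); field.
have y3 : y ^+ 3 = N%:R * N%:R `^ p^-1.
  rewrite -[X in X * _](powRr1 (ltW N0)) exprS expr2 !powD; congr (powR _ _).
  by rewrite /delta; field; rewrite gt_eqF.
have yN : N%:R `^ p^-1 = y * N%:R `^ (- delta).
  by rewrite powD; congr (powR _ _); rewrite /delta; field; rewrite gt_eqF.
have y1 : 1 <= y.
  have delta1 : 0 <= (1 - delta) / 2.
    rewrite divr_ge0 // subr_ge0 /delta ler_pdivrMr ?mulr_gt0 // mul1r; lra.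
  rewrite [leLHS](_ : 1 = 1 `^ ((1 - delta) / 2)); last by rewrite powR1.
  by apply: ge0_ler_powR; rewrite ?nnegrE // ltW.
have [k /andP[qy yq]] := power2_below R y y1.
have q0 : 0 < (2 ^ k)%:R :> R by rewrite ltr0n expn_gt0.
have Nq : (N <= (2 ^ k) ^ 3)%N.
  rewrite -(ler_nat R) natrX -(ler_pM2l (_ : 0 < 8)) //.
  have -> : 8 * (2 ^ k)%:R ^+ 3 = (2 * (2 ^ k)%:R) ^+ 3 :> R by ring.
  apply: (le_trans (y := y ^+ 3)); first by rewrite y3 mulrC ler_wpM2l // ltW.
  by rewrite lerXn2r ?nnegrE ?mulr_ge0 // ltW.
exists k; last split => //.
- case: k Nq {qy yq q0} => // Nq.
  have Nle1 : N%:R <= 1 :> R by rewrite (ler_nat R N 1).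
  by have := le_trans N8' Nle1; rewrite (ler_nat R 8 1).
- by rewrite natrX -y2 lerXn2r // nnegrE ltW.
rewrite yN mulrA ler_wpM2r ?powR_ge0 //.
by rewrite mulrAC ler_pdivrMr //; lra.
Qed.

Theorem mainTheorem15 (R : realType) (p : R) (p_gt2 : 2 < p) :
  exists delta C : R, 0 < delta /\ 0 < C /\
  exists N0 : nat, forall N : nat, (N0 <= N)%N ->
  exists (d : measure_display) (T : measurableType d) (P : probability T R)
         (xi : 'I_N -> LfunType P (le1_of_gt2 p_gt2)),
    [/\ mutually_independent (fun i => xi i : {RV P >-> R}),
        identically_distributed (fun i => xi i : {RV P >-> R}),
        forall i, ('E_P[xi i] = 0)%E,
        forall i, ('E_P[fun t => (`|xi i t| `^ p)%R] = 1)%E &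
        (Lp_width (N%:R `^ (1 - delta)) (range xi)
           <= (C * N%:R `^ (- delta))%:E)%E].
Proof.
have p0 : 0 < p by exact: lt_trans p_gt2.
pose B := (p `^ p * expR (expR 1 - 1)) `^ p^-1.
have B0 : 0 < B by rewrite powR_gt0 // mulr_gt0 ?powR_gt0 ?expR_gt0.
exists ((p - 2) / (3 * p)), (4 * B); split.
  by rewrite divr_gt0 ?mulr_gt0 // subr_gt0.
split; first by rewrite mulr_gt0.
(* N >= 8^p amounts to the N^(1/p) >= 8 on which the choice of scale rests *)
exists (Num.truncn (8 `^ p : R)).+1 => N N0N.
have N_gt0 : (0 < N)%N by exact: leq_trans N0N.
have N8 : 8 `^ p <= N%:R :> R.
  have [_ /ltW /le_trans] := andP (truncn_itv (powR_ge0 (8 : R) p)).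
  by apply; rewrite ler_nat.
have [k k0 [Nk kx kN]] := scale_choice R p N p_gt2 N8.
exists _, _, _, (spike R p p_gt2 N N_gt0); split.
- exact: spike_independent.
- exact: spike_identically_distributed.
- move=> i; rewrite (expectation_spike R p p_gt2 N N_gt0 id).
  by rewrite mulr0 subr0 subrr mul0r addr0.
- move=> i; rewrite (expectation_spike R p p_gt2 N N_gt0 (fun y => `|y| `^ p)).
  rewrite normrN normr0 powR0 ?gt_eqF // mulr0 subr0 add0r.
  rewrite ger0_norm ?powR_ge0 // -powRrM mulVf ?gt_eqF // powRr1 //.
  by congr (_%:E); field; rewrite pnatr_eq0 -lt0n.
apply: le_trans (width_spike R p p_gt2 N N_gt0 k _ k0 Nk kx) _.
by rewrite lee_fin [leRHS]mulrAC ler_wpM2r // ltW.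
Qed.
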